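(* Fix an integer $b\ge2$ and $\gamma\in(0,1)$. Let $\phi$ be a real analytic $\mathbb{Z}$-periodic function satisfying condition (H), and assume $\alpha<\min\{1,\frac{\log b}{\log(1/\gamma)}\}$. Then for any $t_0>0$ there exist an integer $t>t_0$, a real number $\Delta_1>0$ and words $\mathbf{h},\mathbf{h}',\mathbf{a}\in\Lambda^t$ such that for every $z\in I_{\mathbf{a}}$ and all $\mathbf{i},\mathbf{j}\in\Lambda^{\#}$ with $\mathbf{h}$ a prefix of $\mathbf{i}$ and $\mathbf{h}'$ a prefix of $\mathbf{j}$: (A.1) $|S'(z,\mathbf{i})|>\Delta_1$ and $|S'(z,\mathbf{j})|>\Delta_1$; (A.2) $|S'(z,\mathbf{i})-S'(z,\mathbf{j})|>\Delta_1$.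
   Context: $\Lambda=\{0,\dots,b-1\}$, $\Lambda^{\#}=\bigcup_{n\ge1}\Lambda^n$, $\Sigma=\Lambda^{\mathbb{Z}_+}$, $\nu$ uniform on $\Lambda$. For a word $\mathbf{j}$ of length $1\le p\le\infty$ and $x\in[0,1]$, $S(x,\mathbf{j})=\sum_{n=1}^p\gamma^{n-1}\phi\big(\frac{x+j_1+j_2b+\cdots+j_nb^{n-1}}{b^n}\big)$, and $S'(x,\mathbf{j})$ is its derivative in $x$. Condition (H): for all $\mathbf{i}\neq\mathbf{j}\in\Sigma$, $x\mapsto S(x,\mathbf{j})-S(x,\mathbf{i})$ is not identically zero. $\alpha$ is the constant such that for Lebesgue-a.e. $x$, the image $m_x$ of $\nu^{\mathbb{Z}_+}$ under $\mathbf{j}\mapsto S(x,\mathbf{j})$ is exact dimensional with dimension $\alpha$. For $\mathbf{a}=a_1\cdots a_t$, $I_{\mathbf{a}}=\big[\frac{a_1+a_2b+\cdots+a_tb^{t-1}}{b^t},\frac{1+a_1+a_2b+\cdots+a_tb^{t-1}}{b^t}\big)$. *)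

(* Defs.v *)
From HB Require Import structures.
From mathcomp Require Import all_boot all_order all_algebra.
From mathcomp Require Import all_classical all_reals all_analysis.
Unset Printing Implicit Defensive.
Import Order.TTheory GRing.Theory Num.Theory.
Import numFieldNormedType.Exports.
Local Open Scope classical_set_scope.
Local Open Scope ring_scope.

(* Digits Lambda = 'I_b, Sigma = nat -> 'I_b
   (index k of a sequence/word = the paper's index k+1). *)

Section Defs.
Context {R : realType}.

Definition real_analytic (f : R -> R) : Prop :=
  forall x0 : R, exists r : R, 0 < r /\ exists c : nat -> R,
    forall x : R, `|x - x0| < r ->
      (fun n => \sum_(k < n) c k * (x - x0) ^+ k) @ \oo --> f x.

Definition Z_periodic (f : R -> R) : Prop := forall x, f (x + 1) = f x.

Definition digval (b : nat) (d : nat -> nat) (n : nat) : R :=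
  \sum_(k < n) (d k)%:R * (b%:R) ^+ k.

Definition word_digits (b : nat) (w : seq 'I_b) : nat -> nat :=
  fun k => nth 0%N (map val w) k.

Definition Sfin (b : nat) (gamma : R) (phi : R -> R) (x : R) (w : seq 'I_b) : R :=
  \sum_(n < size w) gamma ^+ n *
     phi ((x + digval b (word_digits b w) n.+1) / (b%:R) ^+ n.+1).

Definition Sinf (b : nat) (gamma : R) (phi : R -> R) (x : R) (j : nat -> 'I_b) : R :=
  limn (fun N => \sum_(n < N) gamma ^+ n *
     phi ((x + digval b (fun k => val (j k)) n.+1) / (b%:R) ^+ n.+1)).

Definition Sfin' (b : nat) (gamma : R) (phi : R -> R) (x : R) (w : seq 'I_b) : R :=
  derive1 (fun y : R => Sfin b gamma phi y w) x.

Definition condH (b : nat) (gamma : R) (phi : R -> R) : Prop :=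
  forall i j : nat -> 'I_b, i <> j ->
    exists x : R, 0 <= x <= 1 /\ Sinf b gamma phi x j - Sinf b gamma phi x i != 0.

Definition Sigma_open (b : nat) (U : (nat -> 'I_b) -> Prop) : Prop :=
  forall j, U j -> exists n : nat,
    forall j', (forall k, (k < n)%N -> j' k = j k) -> U j'.

Definition cyl (b n : nat) (w : n.-tuple 'I_b) : (nat -> 'I_b) -> Prop :=
  fun j => forall k : 'I_n, j k = tnth w k.

(** nu^{Z_+}(U) for an open U (nu uniform on Lambda):
    supremum over n of the proportion of length-n cylinders contained in U. *)
Definition bern_open (b : nat) (U : (nat -> 'I_b) -> Prop) : R :=
  sup (range (fun n : nat =>
    (#|[set w : n.-tuple 'I_b | `[< forall j, cyl b n w j -> U j >]]|%:R
       / (b%:R) ^+ n))).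

(** E is nu^{Z_+}-null (outer regularity of the Bernoulli measure) *)
Definition bern_null (b : nat) (E : (nat -> 'I_b) -> Prop) : Prop :=
  forall eps : R, 0 < eps -> exists U, Sigma_open b U /\
    (forall j, E j -> U j) /\ bern_open b U < eps.

Definition m_ball (b : nat) (gamma : R) (phi : R -> R) (x y r : R) : R :=
  bern_open b (fun j : nat -> 'I_b => `|Sinf b gamma phi x j - y| < r).

(** m_x is exact dimensional with dimension alpha: for m_x-a.e. y,
    log m_x(B(y,r)) / log r -> alpha as r -> 0+.  Since m_x is the image of
    nu^{Z_+} under j |-> S(x,j), "m_x-a.e. y" is "nu^{Z_+}-a.e. j, y = S(x,j)". *)
Definition exact_dim (b : nat) (gamma : R) (phi : R -> R) (x alpha : R) : Prop :=
  bern_null b (fun j : nat -> 'I_b =>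
    ~ ((fun r => ln (m_ball b gamma phi x (Sinf b gamma phi x j) r) / ln r)
         @ 0^'+ --> alpha)).

Definition Iword (b : nat) (a : seq 'I_b) : set R :=
  [set z | digval b (word_digits b a) (size a) / (b%:R) ^+ (size a) <= z /\
           z < (1 + digval b (word_digits b a) (size a)) / (b%:R) ^+ (size a)].
End Defs.

(* Main.v *)
Require Import Defs.
From HB Require Import structures.
From mathcomp Require Import all_boot all_order all_algebra.
From mathcomp Require Import all_classical all_reals all_analysis.
From mathcomp Require Import ring lra zify.
Import Order.TTheory GRing.Theory Num.Theory.
Import numFieldNormedType.Exports.
Local Open Scope classical_set_scope.
Local Open Scope ring_scope.

Set Implicit Arguments.
Unset Strict Implicit.

(** Write [q = gamma / b].  The derivative of [S(., w)] is again a sum of the same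
    shape, with ratio [q] and potential [phi' / b], so appending letters to [w]
    moves [S'(., w)] by at most [C q^|w|].  The crux is to find [x] and words [u], [v]
    of a common length [N] with [|S'(x, u) - S'(x, v)| > 3 C q^N].  If there are none,
    the mean value theorem shows that all [S(., j)], [j] in [Sigma], agree on [[0, 1]]
    up to constants, so [kappa = S(1, j) - S(0, j)] does not depend on [j].  Let [[k]]
    be the base [b] expansion of [k].  Periodicity gives [S(x + 1, [k]) = S(x, [k + 1])],
    hence [S(0, [k]) = S(0, [0]) + k kappa]; this is bounded, so [kappa = 0] and
    [S(., [1]) = S(., [0])] on [[0, 1]], against (H).

    Swapping [u] and [v] if necessary, [|S'(x, u)| > 3/2 C q^N].  Both inequalities
    persist on an interval [I_a] around [x], and [h = u a u], [h' = u a v] (padded to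
    length [t]) work: both start with [u], and after reading [u a] every point of
    [[0, 1)] has been sent into [I_a], where [u] and [v] separate. *)

(** * Derivatives of real analytic functions *)

Section PowerSeries.
Context {R : realType}.
Implicit Types (c : nat -> R) (f : R -> R).

(** Comparison with the series of [|c i| * r ^+ i], shifted by one index, at a radius [r] strictly
    between [|z|] and [|K|]. *)
Lemma is_cvg_pseries_diffs c (K z : R) :
  cvgn (pseries c K) -> `|z| < `|K| -> cvgn (pseries (pseries_diffs c) z).
Proof.
move=> cK zK; pose r := (`|z| + `|K|) / 2.
have /andP[zr rK] : `|z| < r < `|K| by rewrite !midf_lt.
have r0 : 0 < r by apply: le_lt_trans zr.
have rz0 : 0 < r - `|z| by rewrite subr_gt0.
have cr : cvgn (pseries (fun i => `|c i|) r).
  by apply: (is_cvg_pseries_inside_norm cK); rewrite gtr0_norm.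
have {}cr : cvgn (series (fun i => (r - `|z|)^-1 * (`|c i.+1| * r ^+ i.+1))).
  rewrite (_ : series _ = fun n => (r - `|z|)^-1 *
      (series (fun i => `|c i| * r ^+ i) n.+1 - `|c 0| * r ^+ 0)); last first.
    apply/funext => n; rewrite /series/= big_nat_recl//= addrAC subrr add0r.
    by rewrite mulr_sumr.
  apply: is_cvgMl_tmp; apply: is_cvgB; last exact: is_cvg_cst.
  by case/cvg_ex: cr => l; rewrite -cvg_shiftS => /cvgP.
apply: normed_cvg; apply: series_le_cvg cr => [i|i|i] //=.
  by rewrite mulr_ge0 ?invr_ge0 ?mulr_ge0 ?exprn_ge0 ?(ltW r0) ?(ltW rz0).
(* [(i + 1) |z|^i <= r^(i + 1) / (r - |z|)], from the factorization of
   [r^(i + 1) - |z|^(i + 1)]. *)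
rewrite /pseries_diffs mulrAC !normrM [`|i.+1%:R|]ger0_norm// normrX.
rewrite [leLHS]mulrC [leRHS]mulrCA ler_wpM2l// ler_pdivlMl//.
have -> : r ^+ i.+1 = (r ^+ i.+1 - `|z| ^+ i.+1) + `|z| ^+ i.+1 by rewrite subrK.
rewrite ler_wpDr ?exprn_ge0// subrXX ler_wpM2l ?(ltW rz0)//.
rewrite mulr_natl -[X in _ *+ X]card_ord -sumr_const ler_sum// => k _.
rewrite [leLHS](_ : _ = `|z| ^+ (i - k) * `|z| ^+ k); last first.
  by rewrite -exprD subnK// -ltnS.
by rewrite ler_wpM2r ?exprn_ge0// lerXn2r ?nnegrE ?(ltW r0)// ltW.
Qed.

Lemma is_derive_pseries c (K x : R) :
  cvgn (pseries c K) -> `|x| < `|K| ->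
  is_derive x 1 (fun x => limn (pseries c x)) (limn (pseries (pseries_diffs c) x)).
Proof.
(* Each formal differentiation costs a strict decrease of the radius, and [pseries_snd_diffs]
   involves two of them: one from [K] to [r], one from [r] to [s]. *)
move=> cK xK; pose r := (`|x| + `|K|) / 2; pose s := (`|x| + r) / 2.
have /andP[xr rK] : `|x| < r < `|K| by rewrite !midf_lt.
have r0 : 0 < r by apply: le_lt_trans xr.
have /andP[xs sr] : `|x| < s < r by rewrite !midf_lt.
have s0 : 0 < s by apply: le_lt_trans xs.
have cr : cvgn (pseries (pseries_diffs c) r).
  by apply: (is_cvg_pseries_diffs cK); rewrite gtr0_norm.
apply: (@pseries_snd_diffs _ c s).
- by apply: (is_cvg_pseries_inside cK); rewrite gtr0_norm// (lt_trans sr).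
- by apply: (is_cvg_pseries_inside cr); rewrite !gtr0_norm.
- by apply: (is_cvg_pseries_diffs cr); rewrite !gtr0_norm.
- by rewrite [ltRHS]gtr0_norm.
Qed.

Lemma real_analytic_near_pseries f (x0 : R) : real_analytic f ->
  exists c (r : R), [/\ 0 < r, cvgn (pseries c r) &
    \forall x \near x0, f x = limn (pseries c (x - x0))].
Proof.
(* Analyticity says nothing on the boundary of the ball, so [r] is halved to get a point of
   convergence. *)
move=> /(_ x0)[r [r0 [c cf]]]; exists c, (r / 2).
have cvf x : `|x - x0| < r -> pseries c (x - x0) @ \oo --> f x.
  rewrite (_ : pseries _ _ = fun n => \sum_(k < n) c k * (x - x0) ^+ k).
    exact: cf.
  by apply/funext => n; rewrite /pseries /series/= big_mkord.
split; first by rewrite divr_gt0.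
  have := cvf (x0 + r / 2); rewrite addrAC subrr add0r => h; apply: cvgP (h _).
  by rewrite gtr0_norm ?divr_gt0// ltr_pdivrMr// ltr_pMr// ltr1n.
near=> x; apply/esym/cvg_lim => //; apply: cvf; rewrite distrC; near: x.
exact: nbhsx_ballx.
Unshelve. all: by end_near. Qed.

Lemma is_derive_pseries_shift c (r x0 x : R) :
  cvgn (pseries c r) -> `|x - x0| < `|r| ->
  is_derive x 1 (fun x => limn (pseries c (x - x0)))
    (limn (pseries (pseries_diffs c) (x - x0))).
Proof.
move=> cr xr; have gd := is_derive_pseries cr xr.
rewrite -[X in is_derive _ _ _ X]mulr1.
exact: (@is_derive1_comp _ _ (shift (- x0)) x _ _ gd (is_derive_shift _ _ _)).
Qed.

Lemma real_analytic_near_is_derive f (x0 : R) : real_analytic f ->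
  exists c (r : R), [/\ 0 < r, cvgn (pseries c r) &
    \forall x \near x0, is_derive (x : R) (1 : R) f (limn (pseries c (x - x0)))].
Proof.
move=> /(real_analytic_near_pseries x0) [c [r [r0 cr fE]]].
exists (pseries_diffs c), (r / 2); split; first by rewrite divr_gt0.
  by apply: (is_cvg_pseries_diffs cr); rewrite !gtr0_norm ?divr_gt0//
    ltr_pdivrMr// ltr_pMr// ltr1n.
(* A derivative at [x] needs the equality on a neighbourhood of [x], for each [x] near [x0]. *)
have fE' := nbhs_interior fE.
near=> x; apply: (@near_eq_is_derive _ _ _ (fun x => limn (pseries c (x - x0)))).
  have : \forall y \near x, f y = limn (pseries c (y - x0)) by near: x; exact: fE'.
  by apply: filterS => y ->.
apply: (is_derive_pseries_shift cr); rewrite distrC [ltRHS]gtr0_norm//.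
Unshelve. all: by end_near. Qed.

Lemma real_analytic_is_derive f (x : R) :
  real_analytic f -> is_derive x 1 f (derive1 f x).
Proof.
move=> /(real_analytic_near_is_derive x)[c [r [_ _ /nbhs_singleton fd]]].
by rewrite derive1E; apply: derivableP; case: fd.
Qed.

(** Near each point the derivative is again the sum of a convergent power series, hence
    differentiable. *)
Lemma real_analytic_continuous_derive1 f : real_analytic f -> continuous (derive1 f).
Proof.
move=> af x; have [c [r [r0 cr fd]]] := real_analytic_near_is_derive x af.
have : {for x, continuous (fun y => limn (pseries c (y - x)))}.
  apply: differentiable_continuous; apply/derivable1_diffP.
  have [] := @is_derive_pseries_shift c r x x cr _; last by [].
  by rewrite subrr normr0 gtr0_norm.
have fE : \forall y \near x, limn (pseries c (y - x)) = derive1 f y.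
  by apply: filterS fd => y yd; rewrite derive1E derive_val.
rewrite /continuous_at -(nbhs_singleton fE).
by apply: cvg_trans; exact: near_eq_cvg.
Qed.
End PowerSeries.

(** * Finite words: inverse branches, the cocycle relation, base [b] intervals *)

Section Words.
Context {R : realType} (b : nat).
Hypothesis b2 : (2 <= b)%N.
Implicit Types (x y : R) (u v w : seq 'I_b) (f : R -> R) (g B : R).

Lemma base_gt0 : 0 < b%:R :> R. Proof. by rewrite ltr0n (leq_trans _ b2). Qed.
Hint Resolve base_gt0 : core.

(* The first letter of [u] acts first and is the least significant digit. *)
Definition wpt x u : R := (x + digval b (word_digits b u) (size u)) / b%:R ^+ size u.

Lemma digval_ext (d d' : nat -> nat) n :
  (forall k, (k < n)%N -> d k = d' k) -> digval b d n = digval b d' n :> R.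
Proof. by move=> dd'; apply: eq_bigr => k _; rewrite dd'. Qed.

Lemma digval_cat u v n : digval b (word_digits b (u ++ v)) (size u + n) =
  digval b (word_digits b u) (size u) +
  b%:R ^+ size u * digval b (word_digits b v) n :> R.
Proof.
rewrite /digval big_split_ord/=; congr (_ + _).
  by apply: eq_bigr => k _; rewrite /word_digits map_cat nth_cat size_map ltn_ord.
rewrite mulr_sumr; apply: eq_bigr => k _.
rewrite /word_digits map_cat nth_cat size_map ltnNge leq_addr/= addKn exprD.
by rewrite mulrCA.
Qed.

Lemma wpt_cat x u v : wpt x (u ++ v) = wpt (wpt x u) v.
Proof.
rewrite /wpt size_cat digval_cat exprD; field.
by rewrite !expf_neq0 ?gt_eqF.
Qed.

Lemma wpt_seq1 x (a : 'I_b) : wpt x [:: a] = (x + a%:R) / b%:R.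
Proof. by rewrite /wpt/digval big_ord_recl big_ord0/= expr1 mulr1 addr0. Qed.

Lemma Sfin_nil g f x : Sfin b g f x [::] = 0.
Proof. by rewrite /Sfin big_ord0. Qed.

(** Cocycle relation: once [u] is read, the base point has moved to [wpt x u] and the weights carry
    a factor [g ^+ size u]. *)
Lemma Sfin_cat g f x u v :
  Sfin b g f x (u ++ v) = Sfin b g f x u + g ^+ size u * Sfin b g f (wpt x u) v.
Proof.
rewrite /Sfin size_cat big_split_ord/=; congr (_ + _).
  apply: eq_bigr => k _; congr (_ * f (_ / _)); congr (_ + _).
  apply: digval_ext => i ik; rewrite /word_digits map_cat nth_cat size_map.
  by rewrite (leq_ltn_trans _ (ltn_ord k)).
rewrite mulr_sumr; apply: eq_bigr => k _; rewrite exprD mulrA; congr (_ * f _).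
rewrite -addnS digval_cat /wpt exprD; field.
by rewrite !expf_neq0 ?gt_eqF.
Qed.

Lemma Sfin_cons g f x (a : 'I_b) w : Sfin b g f x (a :: w) =
  f (wpt x [:: a]) + g * Sfin b g f (wpt x [:: a]) w.
Proof.
rewrite -cat1s Sfin_cat expr1; congr (_ + _).
by rewrite /Sfin big_ord_recl big_ord0/= mul1r addr0.
Qed.

Lemma Sfin_bound g f B x w : 0 <= g < 1 -> (forall y, `|f y| <= B) ->
  `|Sfin b g f x w| <= B / (1 - g).
Proof.
move=> /andP[g0 g1] fB; have B0 : 0 <= B by apply: le_trans (fB 0).
have g1' : 0 < 1 - g by rewrite subr_gt0.
elim: w x => [|a w IH] x; first by rewrite Sfin_nil normr0 divr_ge0 ?(ltW g1').
rewrite Sfin_cons (le_trans (ler_normD _ _))//.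
(* The bound is the fixed point of [M |-> B + g * M], which makes the induction close. *)
rewrite [leRHS](_ : _ = B + g * (B / (1 - g))); last by field; rewrite gt_eqF.
by rewrite lerD// normrM ger0_norm// ler_wpM2l.
Qed.

Lemma Sfin_continuous g f w : continuous f -> continuous (fun x => Sfin b g f x w).
Proof.
move=> cf; elim: w => [|a w IH] x.
  under eq_fun do rewrite Sfin_nil; exact: cvg_cst.
under eq_fun do rewrite Sfin_cons wpt_seq1.
have cp : {for x, continuous (fun y : R => (y + a%:R) / b%:R)}.
  by apply: cvgM; [apply: cvgD; [exact: cvg_id|]|]; exact: cvg_cst.
apply: cvgD.
  exact: (continuous_comp cp (cf _)).
apply: cvgM; first exact: cvg_cst.
exact: (continuous_comp cp (IH _)).
Qed.

(** Each letter contracts by [1 / b], so the chain rule puts one factor [1 / b] on the potential and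
    one on the ratio. *)
Lemma is_derive_Sfin g f f' w x :
  (forall y : R, is_derive y 1 f (f' y)) ->
  is_derive x 1 (fun y => Sfin b g f y w) (Sfin b (g / b%:R) (fun y => f' y / b%:R) x w).
Proof.
move=> fd; elim: w x => [|a w IH] x.
  under eq_fun do rewrite Sfin_nil; rewrite Sfin_nil; exact: is_derive_cst.
under eq_fun do rewrite Sfin_cons; rewrite Sfin_cons.
have dp : is_derive x 1 (fun y => wpt y [:: a]) (b%:R^-1).
  under eq_fun do rewrite wpt_seq1.
  by apply: is_derive_eq; rewrite !scaler0 add0r addr0 scaler1.
have d1 := is_derive1_comp (fd _) dp.
have d2 := is_derive1_comp (IH _) dp.
apply: (@is_derive_eq _ _ _ _ _ _ _ _ (is_deriveD d1 (is_deriveZ g d2))).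
rewrite /GRing.scale/=; ring.
Qed.

Lemma Iword_wpt (a : seq 'I_b) x : 0 <= x < 1 -> Iword b a (wpt x a).
Proof.
move=> /andP[x0 x1]; rewrite /Iword/wpt/=; have p0 : 0 < (b%:R ^+ size a)^-1 :> R.
  by rewrite invr_gt0 exprn_gt0.
by rewrite ler_pM2r// ltr_pM2r// lerDr ltrD2r.
Qed.

Lemma Iword_dist (a : seq 'I_b) x y :
  Iword b a x -> Iword b a y -> `|x - y| < (b%:R ^+ size a)^-1.
Proof.
rewrite /Iword/= => -[x1 x2] [y1 y2]; rewrite mulrDl mul1r in x2 y2.
rewrite ltr_norml; lra.
Qed.

Lemma exists_Iword n x : 0 <= x < 1 -> exists2 a : seq 'I_b, size a = n & Iword b a x.
Proof.
move=> x01.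
suff [a [y [an y01 ->]]] : exists (a : seq 'I_b) y,
    [/\ size a = n, 0 <= y < 1 & x = wpt y a].
  by exists a => //; exact: Iword_wpt.
elim: n x x01 => [|n IH] x /andP[x0 x1].
  exists [::], x; split => //; first by rewrite x0.
  by rewrite /wpt/digval big_ord0/= expr0 addr0 divr1.
have bx0 : 0 <= b%:R * x by rewrite mulr_ge0// ltW.
have bxb : (Num.truncn (b%:R * x) < b)%N by rewrite truncn_lt_nat// gtr_pMr.
have /IH[a [y [an y01 xy]]] : 0 <= b%:R * x - (Num.truncn (b%:R * x))%:R < 1.
  by rewrite subr_ge0 truncn_le bx0 ltrBlDl natr1 truncnS_gt.
(* The integer part of [b * x] is the most significant digit, hence the last letter; the fractional
   part gives the others. *)
exists (rcons a (Ordinal bxb)), y; split => //; first by rewrite size_rcons an.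
rewrite -cats1 wpt_cat -xy wpt_seq1/= subrK mulrC mulKf// gt_eqF//.
Qed.
End Words.

(** * Periodic functions *)

Section Periodic.
Context {R : realType}.
Implicit Types (f : R -> R) (x y : R).

Lemma Z_periodicDn f x n : Z_periodic f -> f (x + n%:R) = f x.
Proof. by move=> pf; elim: n => [|n IH]; rewrite ?addr0// -natr1 addrA pf. Qed.

Lemma Z_periodic_fract f x : Z_periodic f -> f x = f (x - (Num.floor x)%:~R).
Proof.
move=> pf; case: (Num.floor x) => n.
  by rewrite -pmulrn -[in LHS](subrK n%:R x) Z_periodicDn.
by rewrite NegzE mulrNz opprK -pmulrn Z_periodicDn.
Qed.

Lemma Z_periodic_bounded f : continuous f -> Z_periodic f ->
  exists2 B : R, 0 < B & forall x, `|f x| <= B.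
Proof.
move=> cf pf.
have cnf : {within `[0, 1], continuous (fun x => `|f x|)}.
  apply: continuous_subspaceT => x.
  exact: (continuous_comp (cf x) (@norm_continuous _ _ _)).
have [c _ fc] := EVT_max ler01 cnf.
exists (`|f c| + 1) => [|x]; first by rewrite ltr_pwDr.
rewrite ler_wpDr// (Z_periodic_fract _ pf); apply: fc.
have /andP[x1 x2] := floor_itv x; rewrite intrD in x2.
by rewrite in_itv/= subr_ge0 x1/= lerBlDl ltW.
Qed.

Lemma Z_periodic_derive1 f : (forall x, is_derive x 1 f (derive1 f x)) ->
  Z_periodic f -> Z_periodic (derive1 f).
Proof.
move=> fd pf x.
have := @is_derive1_comp _ f (shift 1) x _ _ (fd _) (is_derive_shift _ _ _).
rewrite (_ : f \o _ = f) ?mulr1; last by apply/funext => y /=; rewrite pf.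
by move=> h; rewrite [RHS]derive1E derive_val.
Qed.

Lemma Z_periodic_modn f x k M : Z_periodic f -> (0 < M)%N ->
  f ((x + k%:R) / M%:R) = f ((x + (k %% M)%:R) / M%:R).
Proof.
move=> pf M0; rewrite [in LHS](divn_eq k M) natrD natrM.
rewrite -[RHS](Z_periodicDn _ (k %/ M) pf); congr f; field.
by rewrite pnatr_eq0 -lt0n.
Qed.
End Periodic.

(** * Infinite words as limits of their prefixes *)

Section Sinf.
Context {R : realType} (b : nat).
Hypothesis b2 : (2 <= b)%N.
Variables (g B : R) (f : R -> R).
Hypotheses (g01 : 0 <= g < 1) (fB : forall y, `|f y| <= B).
Implicit Types (x : R) (j : nat -> 'I_b).

Lemma Sfin_mkseq x j N : Sfin b g f x (mkseq j N) =
  \sum_(n < N) g ^+ n * f ((x + digval b (fun k => val (j k)) n.+1) / b%:R ^+ n.+1).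
Proof.
rewrite /Sfin size_mkseq; apply: eq_bigr => n _; congr (_ * f ((x + _) / _)).
apply: digval_ext => k kn; rewrite /word_digits (nth_map (j 0)) ?size_mkseq ?nth_mkseq//.
  exact: leq_trans kn _.
exact: leq_trans kn _.
Qed.

(** The [limn] in [Sinf] is a genuine limit, since the terms are dominated by [B * g ^+ n]. *)
Lemma cvg_Sfin x j : (fun N => Sfin b g f x (mkseq j N)) @ \oo --> Sinf b g f x j.
Proof.
have /andP[g0 g1] := g01; rewrite /Sinf; under eq_fun do rewrite Sfin_mkseq.
set t := fun n => g ^+ n * f ((x + digval b (fun k => val (j k)) n.+1) / b%:R ^+ n.+1).
rewrite (_ : (fun N => _) = series t); last first.
  by apply/funext => n; rewrite /series/= big_mkord.
apply: normed_cvg; apply: (@series_le_cvg _ _ (geometric B g)) => [n|n|n|].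
- by rewrite /= normr_ge0.
- by rewrite /= mulr_ge0 ?exprn_ge0// (le_trans _ (fB 0)).
- by rewrite /= normrM ger0_norm ?exprn_ge0// mulrC ler_wpM2r ?exprn_ge0.
- by apply: is_cvg_geometric_series; rewrite ger0_norm.
Qed.

Lemma Sinf_bound x j : `|Sinf b g f x j| <= B / (1 - g).
Proof.
apply: (cvgr_to_le (cvg_norm (@cvg_Sfin x j))); apply: nearW => N.
exact: Sfin_bound.
Qed.
End Sinf.

(** * Base [b] expansions of natural numbers and the odometer *)

Section Natword.
Context {R : realType} (b : nat).
Hypothesis b2 : (2 <= b)%N.

Definition natword (k : nat) : nat -> 'I_b :=
  fun n => Ordinal (ltn_pmod (k %/ b ^ n) (ltnW b2)).

Lemma digvalS (d : nat -> nat) n :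
  digval b d n.+1 = digval b d n + (d n)%:R * b%:R ^+ n :> R.
Proof. by rewrite /digval big_ord_recr. Qed.

Lemma digval_natword k n : digval b (fun i => val (natword k i)) n = (k %% b ^ n)%:R :> R.
Proof.
elim: n => [|n IH]; first by rewrite /digval big_ord0 expn0 modn1.
rewrite digvalS IH/= -natrX -natrM -natrD.
congr _%:R; set M := (b ^ n)%N.
have M0 : (0 < M)%N by rewrite expn_gt0 (ltnW b2).
rewrite [in RHS](divn_eq k M) [in RHS](divn_eq (k %/ M) b) expnSr -/M.
rewrite mulnDl -mulnA [(b * M)%N]mulnC -addnA modnMDl [in RHS]modn_small.
  by rewrite addnC.
have := ltn_pmod k M0; have := ltn_pmod (k %/ M) (ltnW b2); nia.
Qed.

(** With [M = b ^ n.+1], the numerators [x + 1 + k %% M] and [x + k.+1 %% M] differ by [0] or [M],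
    which is invisible to [f] after division by [M]. *)
Lemma Sinf_natwordS (g : R) (f : R -> R) x k : Z_periodic f ->
  Sinf b g f (x + 1) (natword k) = Sinf b g f x (natword k.+1).
Proof.
move=> pf; rewrite /Sinf; congr (limn _); apply/funext => N.
apply: eq_bigr => n _; congr (_ * _); rewrite !digval_natword -!natrX.
have M0 : (0 < b ^ n.+1)%N by rewrite expn_gt0 (ltnW b2).
rewrite -addrA nat1r [LHS](Z_periodic_modn _ _ pf M0).
by rewrite -[(k %% _).+1]addn1 modnDml addn1.
Qed.
End Natword.

(** * Two words with well separated derivatives *)

Section Separation.
Context {R : realType} (b : nat).
Hypothesis b2 : (2 <= b)%N.
Variables (gamma : R) (phi : R -> R).
Hypotheses (gamma01 : 0 < gamma < 1)
  (phi_deriv : forall x : R, is_derive x 1 phi (derive1 phi x))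
  (phi_periodic : Z_periodic phi).
Local Notation q := (gamma / b%:R).
Local Notation psi := (fun y : R => derive1 phi y / b%:R).

Lemma ratio_itv : 0 < q < 1.
Proof.
have /andP[g0 g1] := gamma01; rewrite divr_gt0 ?base_gt0//= ltr_pdivrMr ?base_gt0//.
by rewrite mul1r (lt_le_trans g1)// ler1n (ltnW b2).
Qed.

Lemma Sfin'E x w : Sfin' b gamma phi x w = Sfin b q psi x w.
Proof.
have := is_derive_Sfin b2 gamma w x phi_deriv.
by rewrite /Sfin' derive1E => h; rewrite derive_val.
Qed.

Lemma phi_continuous : continuous phi.
Proof.
by move=> x; apply: differentiable_continuous; apply/derivable1_diffP; case: (phi_deriv x).
Qed.

(** The mean value theorem is applied to the truncations at length [N]: their difference varies by
    at most [D * q ^+ N] on [[0, 1]], and this tends to [0]. *)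
Lemma Sinf_diff_cst D i j (x : R) :
  (forall u v (y : R), size u = size v -> 0 <= y < 1 ->
    `|Sfin b q psi y u - Sfin b q psi y v| <= D * q ^+ size u) ->
  0 <= x <= 1 ->
  Sinf b gamma phi x i - Sinf b gamma phi x j =
  Sinf b gamma phi 0 i - Sinf b gamma phi 0 j.
Proof.
move=> close /andP[x0 x1]; have /andP[q0 q1] := ratio_itv.
have g01 : 0 <= gamma < 1 by have /andP[/ltW-> ->] := gamma01.
have [B _ phiB] := Z_periodic_bounded phi_continuous phi_periodic.
pose P N y := Sfin b gamma phi y (mkseq i N) - Sfin b gamma phi y (mkseq j N).
have cP y : (fun N => P N y) @ \oo --> Sinf b gamma phi y i - Sinf b gamma phi y j.
  by apply: cvgB; exact: (cvg_Sfin g01 phiB).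
have Pd N (y : R) : is_derive y 1 (P N)
    (Sfin b q psi y (mkseq i N) - Sfin b q psi y (mkseq j N)).
  by apply: is_deriveB; exact: is_derive_Sfin.
have Pclose N : `|P N x - P N 0| <= D * q ^+ N.
  (* The hypothesis at [0] yields [0 <= D * q ^+ N], which settles the degenerate case [x = 0]. *)
  have := close (mkseq i N) (mkseq j N) 0; rewrite !size_mkseq lexx ltr01.
  move=> /(_ erefl isT) D0; have {}D0 := le_trans (normr_ge0 _) D0.
  move: x0; rewrite le_eqVlt => /predU1P[<-|x0]; first by rewrite subrr normr0.
  have [|c] := @MVT _ (P N) _ 0 x x0 (fun y _ => Pd N y).
    apply: continuous_subspaceT => y; apply: differentiable_continuous.
    by apply/derivable1_diffP; case: (Pd N y).
  rewrite in_itv/= => /andP[c0 cx] ->; rewrite subr0 normrM (gtr0_norm x0).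
  rewrite -[leRHS]mulr1 ler_pM// ?(ltW x0)//.
  rewrite -[in leRHS](size_mkseq i N); apply: close; rewrite ?size_mkseq//.
  by rewrite (ltW c0) (lt_le_trans cx).
apply/eqP; rewrite -subr_eq0 -normr_le0.
apply: (ler_cvg_to (cvg_norm (cvgB (cP x) (cP 0))) (@cvg_geometric _ D q _)).
  by rewrite gtr0_norm.
exact: nearW.
Qed.

Lemma exists_separated D : condH b gamma phi -> exists u v (x : R),
  [/\ size u = size v, 0 <= x < 1 &
      D * q ^+ size u < `|Sfin b q psi x u - Sfin b q psi x v|].
Proof.
move=> H; apply: contrapT => nsep.
have g01 : 0 <= gamma < 1 by have /andP[/ltW-> ->] := gamma01.
have [B _ phiB] := Z_periodic_bounded phi_continuous phi_periodic.
have cst i j x := @Sinf_diff_cst D i j x.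
have {}cst i j x : 0 <= x <= 1 -> Sinf b gamma phi x i - Sinf b gamma phi x j =
  Sinf b gamma phi 0 i - Sinf b gamma phi 0 j.
  apply: cst => u v y uv y01; rewrite leNgt; apply/negP => sep; apply: nsep.
  by exists u, v, y.
pose F k : R := Sinf b gamma phi 0 (natword b2 k).
have F1 k : Sinf b gamma phi 1 (natword b2 k) = F k.+1.
  by rewrite -[1]add0r (Sinf_natwordS b2 gamma 0 k phi_periodic).
(* Comparing the words of [k] and [0] at [x = 1] and at [x = 0] shows that [F] is an arithmetic
   progression. *)
have FS k : F k.+1 - F k = F 1%N - F 0%N.
  have := cst (natword b2 k) (natword b2 0) 1; rewrite ler01 lexx => /(_ isT).
  rewrite !F1 -/(F _) -/(F _); lra.
have Fk k : F k = F 0%N + k%:R * (F 1%N - F 0%N).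
  elim: k => [|k IH]; first by rewrite mul0r addr0.
  by have := FS k; rewrite IH -natr1; lra.
have F10 : F 1%N = F 0%N.
  pose M := B / (1 - gamma).
  have FM k : `|F k| <= M by exact: (Sinf_bound b2 g01 phiB).
  apply: contrapT => /eqP; rewrite -subr_eq0 -normr_gt0 => d0.
  (* For this [k], [|F k - F 0|] would exceed [2 * M], although [F] is bounded by [M]. *)
  pose k := (Num.truncn ((M + M) / `|F 1%N - F 0%N|)).+1.
  have : M + M < k%:R * `|F 1%N - F 0%N| by rewrite -ltr_pdivrMr// truncnS_gt.
  rewrite -[k%:R]ger0_norm// -normrM.
  have -> : k%:R * (F 1%N - F 0%N) = F k - F 0%N by rewrite (Fk k); ring.
  by rewrite ltNge (le_trans (ler_normB _ _))// lerD.
have ne : natword b2 0 <> natword b2 1.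
  by move=> /(congr1 (fun d => val (d 0%N))); rewrite /= expn0 !divn1 mod0n modn_small.
have [x [x01]] := H _ _ ne.
by rewrite cst// -/(F _) -/(F _) F10 subrr eqxx.
Qed.
End Separation.

(** * Position and length of the intervals of words *)

Section WordIntervals.
Context {R : realType} (b : nat).
Hypothesis b2 : (2 <= b)%N.

Lemma Iword_itv (a : seq 'I_b) (z : R) : Iword b a z -> 0 <= z < 1.
Proof.
have p0 : 0 < b%:R ^+ size a :> R by rewrite exprn_gt0// base_gt0.
rewrite /Iword/= ler_pdivrMr// ltr_pdivlMr// => -[z0 z1].
have d0 : 0 <= digval b (word_digits b a) (size a) :> R.
  by apply: sumr_ge0 => k _; rewrite mulr_ge0// exprn_ge0.
have d1 n : 1 + digval b (word_digits b a) n <= b%:R ^+ n :> R.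
  elim: n => [|n IH]; first by rewrite /digval big_ord0 addr0.
  rewrite digvalS addrA exprS (le_trans (lerD IH (lexx _)))//.
  rewrite -{1}[b%:R ^+ n]mul1r -mulrDl ler_wpM2r ?exprn_ge0// nat1r ler_nat.
  (* Past the end of the word the digit is the default [0], still below [b]. *)
  rewrite /word_digits; have [na|an] := ltnP n (size (map val a)).
    have /mapP[k _ ->] := mem_nth 0%N na; exact: ltn_ord.
  by rewrite nth_default// (ltnW b2).
rewrite -(pmulr_lge0 _ p0) (le_trans d0)//= -(ltr_pM2r p0) mul1r.
exact: lt_le_trans z1 (d1 _).
Qed.

Lemma exists_expr_lt (rho : R) : 0 < rho ->
  exists n, forall m, (n <= m)%N -> (b%:R ^+ m)^-1 < rho.
Proof.
move=> rho0; exists (Num.truncn rho^-1).+1 => m nm.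
have p0 : 0 < b%:R ^+ m :> R by rewrite exprn_gt0// base_gt0.
rewrite invf_plt ?posrE// (lt_le_trans (truncnS_gt _))// -natrX ler_nat.
by rewrite (leq_trans nm)// ltnW// ltn_expl.
Qed.
End WordIntervals.

(** * Construction of the words [h], [h'] and [a] *)

Unset Implicit Arguments.
Set Strict Implicit.

Theorem theorem6p1 (R : realType) (b : nat) (gamma : R) (phi : R -> R) (alpha : R) :
  (2 <= b)%N -> 0 < gamma < 1 ->
  real_analytic phi -> Z_periodic phi -> condH b gamma phi ->
  (@lebesgue_measure R).-negligible
     [set x : R | 0 <= x <= 1 /\ ~ exact_dim b gamma phi x alpha] ->
  alpha < Num.min 1 (ln (b%:R : R) / ln (gamma^-1)) ->
  forall t0 : R, 0 < t0 ->
  exists t : nat, t0 < t%:R /\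
  exists Delta1 : R, 0 < Delta1 /\
  exists h h' a : seq 'I_b, [/\ size h = t, size h' = t & size a = t] /\
  forall z : R, Iword b a z ->
  forall i j : seq 'I_b, (0 < size i)%N -> (0 < size j)%N ->
    (exists s, i = h ++ s) -> (exists s', j = h' ++ s') ->
    [/\ Delta1 < `|Sfin' b gamma phi z i|,
        Delta1 < `|Sfin' b gamma phi z j| &
        Delta1 < `|Sfin' b gamma phi z i - Sfin' b gamma phi z j|].
Proof.
move=> b2 g01 phi_an phi_per H _ _ t0 t0_gt0.
have phi_d (x : R) : is_derive x 1 phi (derive1 phi x) by exact: real_analytic_is_derive.
pose q := gamma / b%:R; pose psi (y : R) := derive1 phi y / b%:R.
have /andP[q0 q1] : 0 < q < 1 by exact: ratio_itv.
have psi_c : continuous psi.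
  by move=> x; apply: cvgM; [exact: real_analytic_continuous_derive1|exact: cvg_cst].
have psi_per : Z_periodic psi.
  by move=> x; rewrite /psi Z_periodic_derive1.
have [B B0 psiB] := Z_periodic_bounded psi_c psi_per.
pose T x w := Sfin b q psi x w; pose C := B / (1 - q).
have C0 : 0 < C by rewrite divr_gt0// subr_gt0.
have tail x u s : `|T x (u ++ s) - T x u| <= C * q ^+ size u.
  rewrite /T Sfin_cat// addrAC subrr add0r normrM ger0_norm ?exprn_ge0// ?(ltW q0)//.
  by rewrite mulrC ler_pM2r ?exprn_gt0//; apply: Sfin_bound => //; rewrite (ltW q0).
(* The factor [3] pays for tails of size at most [C * q ^+ N], [N] being the common length: two of
   them leave a gap [C * q ^+ N] between [u] and [v], and one leaves half of that for [u] alone. *)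
have [u [v [x [uv x01 sep_uv sep_u]]]] : exists u v (x : R),
  [/\ size u = size v, 0 <= x < 1,
    3 * C * q ^+ size u < `|T x u - T x v| & 3 * C * q ^+ size u < 2 * `|T x u|].
  have [u [v [x [uv x01 sep]]]] := exists_separated b2 g01 phi_d phi_per (3 * C) H.
  have [vu|/ltW vu] := lerP `|T x v| `|T x u|.
    exists u, v, x; split => //.
    apply: (lt_le_trans sep); rewrite (le_trans (ler_normB _ _))//.
    by rewrite mulr_natl mulr2n lerD.
  exists v, u, x; rewrite -uv distrC; split => //.
  apply: (lt_le_trans sep); rewrite (le_trans (ler_normB _ _))//.
  by rewrite mulr_natl mulr2n lerD.
pose N := size u.
have T_c w : {for x, continuous (fun y => T y w)} by exact: Sfin_continuous.
have [rho rho0 near_x] : exists2 rho : R, 0 < rho & forall y : R, `|x - y| < rho ->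
    3 * C * q ^+ N < `|T y u - T y v| /\ 3 * C * q ^+ N < 2 * `|T y u|.
  have : \forall y \near x,
      3 * C * q ^+ N < `|T y u - T y v| /\ 3 * C * q ^+ N < 2 * `|T y u|.
    apply: filterI.
      exact: (cvgr_gt _ (cvg_norm (cvgB (T_c u) (T_c v)))).
    have c2 : (fun y => 2 * `|T y u|) @ x --> 2 * `|T x u|.
      by apply: cvgM; [exact: cvg_cst|exact: cvg_norm (T_c u)].
    exact: (cvgr_gt _ c2).
  by move=> /nbhs_ballP[rho /= rho0 near_x]; exists rho.
have [n small] := exists_expr_lt b2 rho0.
(* Two intervals around [x] are used: that of [a], of length [n], steers orbits back near [x] inside
   [h] and [h']; that of [a'], of length [t], is where [z] ranges. *)
have [a an xa] := exists_Iword b2 n x01.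
pose t := maxn (N + n + N) (Num.truncn t0).+1.
have [a' a't xa'] := exists_Iword b2 t x01.
have Nt : (N + n + N <= t)%N by exact: leq_maxl.
pose pad := nseq (t - (N + n + N)) (Ordinal (ltnW b2)).
have size_pad w : size w = N -> size (u ++ a ++ w ++ pad) = t.
  by move=> wN; rewrite !size_cat size_nseq wN an !addnA subnKC.
exists t; split.
  by rewrite (lt_le_trans (truncnS_gt _))// ler_nat leq_maxr.
have p0 m : 0 < q ^+ m by exact: exprn_gt0.
have Cq : 0 < C * q ^+ N by rewrite mulr_gt0.
(* The factor [q ^+ (N + n)] is the weight acquired by reading [u ++ a]; [C * q ^+ N / 2] is the
   margin for [u] alone, the smaller of the two. *)
exists (q ^+ (N + n) * (C * q ^+ N / 2)); split.
  by rewrite mulr_gt0// divr_gt0.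
exists (u ++ a ++ u ++ pad), (u ++ a ++ v ++ pad), a'; split.
  by split; [exact: size_pad|exact: size_pad|exact: a't].
move=> z za' i j _ _ [s ->] [s' ->]; rewrite !Sfin'E//.
rewrite -/q -/psi -!catA.
have z01 := Iword_itv b2 za'.
have zx : `|x - z| < rho.
  apply: (lt_trans (Iword_dist xa' za')); rewrite a't; apply: small.
  by rewrite (leq_trans _ Nt)// -addnA addnCA leq_addr.
have Delta_le : q ^+ (N + n) * (C * q ^+ N / 2) <= C * q ^+ N / 2.
  by rewrite ler_piMl ?exprn_ile1 ?(ltW q0) ?(ltW q1)// ?ltW// divr_gt0.
have u_large w : q ^+ (N + n) * (C * q ^+ N / 2) < `|T z (u ++ w)|.
  apply: (le_lt_trans Delta_le); have [_ zu] := near_x z zx.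
  have := tail z u w; have := lerB_dist (T z u) (T z (u ++ w)); rewrite distrC -/N.
  lra.
split; [exact: u_large|exact: u_large|].
(* Wherever [wpt z u] lies in [[0, 1)], reading [a] sends it into the interval of [a], hence within
   [rho] of [x]. *)
pose y := wpt (wpt z u) a.
have yx : `|x - y| < rho.
  apply: (lt_trans (Iword_dist xa (Iword_wpt b2 a _))); last by rewrite an small.
  exact: (Iword_itv b2 (Iword_wpt b2 u z01)).
have [yuv _] := near_x y yx.
(* The contributions of the common prefix [u ++ a] cancel, leaving the weighted difference at
   [y]. *)
rewrite ![Sfin _ _ _ _ (u ++ _)]Sfin_cat// ![Sfin _ _ _ _ (a ++ _)]Sfin_cat// -/y.
rewrite [X in _ < `|X|](_ : _ = q ^+ (N + n) *
  (T y (u ++ pad ++ s) - T y (v ++ pad ++ s'))); last first.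
  by rewrite /T an exprD; ring.
rewrite normrM (gtr0_norm (p0 _)) ltr_pM2l//.
have := tail y u (pad ++ s); have := tail y v (pad ++ s'); rewrite -uv -/N => tv tu.
move: yuv tv tu; rewrite !ltr_normr !ler_norml; lra.
Qed.
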